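(* There is a real-valued function $f(c,k,\ell)$, defined for real $c\ge 1$ and integers $k,\ell\ge 1$, such that for every fixed $c$ and $k$ one has $f(c,k,\ell)\to 0$ as $\ell\to\infty$, and such that the following holds. For every real $c\ge 1$ and all integers $\ell,k\ge 1$ there is $n_0=n_0(c,k,\ell)$ such that for all $n\ge n_0$: if $S\subseteq \mathbb{C}[x]$ is a set of $n$ polynomials, none of which is a scalar multiple of another, and $$|S^\ell| < n^c,$$ then $$|kS| > n^{k-f(c,k,\ell)} .$$
   Context: For a finite set $S\subseteq\mathbb{C}[x]$, $S^\ell := \{s_1 s_2\cdots s_\ell : s_1,\dots,s_\ell\in S\}$ is the $\ell$-fold product set and $kS := \{s_1+\cdots+s_k : s_1,\dots,s_k\in S\}$ is the $k$-fold sumset. ''Scalar multiple'' means multiple by an element of $\mathbb{C}$. *)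

(* Defs.v *)
From mathcomp Require Import all_boot all_order all_algebra finmap.

Set Implicit Arguments.
Unset Strict Implicit.
Unset Printing Implicit Defensive.

Import GRing.Theory.
Local Open Scope ring_scope.
Local Open Scope fset_scope.

(* The coercion of S to its subtype of elements makes s below range over all
   l-tuples (resp. k-tuples) of elements of S, repetitions allowed. *)
Definition prodset (T : comPzSemiRingType) (l : nat) (S : {fset T}) : {fset T} :=
  [fset \prod_(i < l) val (s i) | s : {ffun 'I_l -> S} in predT].

Definition sumset (T : nmodType) (k : nat) (S : {fset T}) : {fset T} :=
  [fset \sum_(i < k) val (s i) | s : {ffun 'I_k -> S} in predT].

Lemma prodsetP (T : comPzSemiRingType) (l : nat) (S : {fset T}) (p : T) :
  p \in prodset l S <->
  exists2 s : 'I_l -> T, (forall i, s i \in S) & p = \prod_(i < l) s i.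
Proof.
split=> [/imfsetP[/= s _ ->]|[s sS ->]].
  by exists (fun i => val (s i)) => // i; apply: valP.
apply/imfsetP; exists [ffun i => [` sS i]] => //=.
by apply: eq_bigr => i _; rewrite ffunE.
Qed.

Lemma sumsetP (T : nmodType) (k : nat) (S : {fset T}) (p : T) :
  p \in sumset k S <->
  exists2 s : 'I_k -> T, (forall i, s i \in S) & p = \sum_(i < k) s i.
Proof.
split=> [/imfsetP[/= s _ ->]|[s sS ->]].
  by exists (fun i => val (s i)) => // i; apply: valP.
apply/imfsetP; exists [ffun i => [` sS i]] => //=.
by apply: eq_bigr => i _; rewrite ffunE.
Qed.

(* Main.v *)
Require Import Defs.
From mathcomp Require Import all_boot all_order all_algebra finmap.
From mathcomp Require Import complex.
From mathcomp Require Import all_classical all_reals all_analysis.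
From mathcomp Require Import perm zify.

(* Put N = (2k)^2 and call two nonzero polynomials congruent when all their root
   multiplicities agree modulo N.

   Let Q be a set of representatives of the classes met by S.  The products
   q_0 q_1^N q_2^(N^2) ... q_(t-1)^(N^(t-1)) with q_i in Q are pairwise distinct,
   by reading root multiplicities in base N, so |Q|^t <= |S^l| < n^c as soon as
   1 + N + ... + N^(t-1) <= l.  Hence some class T has at least n^(1 - c/t)
   elements, with t of order log l.

   The elements of T become N-th powers after multiplication by the (N-1)-st
   power of one of them.  By a Mason-Stothers argument, at most 2k pairwise
   nonproportional N-th powers are linearly independent, so a k-fold sum of
   elements of T determines its summands and |kS| >= |T|^k / k^k. *)

Import Order.TTheory GRing.Theory Num.Theory.
Import numFieldNormedType.Exports.
Local Open Scope ring_scope.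

(** * The Euler operator and nonvanishing of Wronskians *)

(* x d/dx rather than d/dx: it is diagonal on monomials. *)
Definition euler (F : nzRingType) (p : {poly F}) : {poly F} := 'X * p^`().

Definition independent (F : fieldType) (I : finType) (f : I -> {poly F}) : Prop :=
  forall c : I -> F, \sum_i c i *: f i = 0 -> forall i, c i = 0.

(** Rectangular, so that the maximal minors of the m by m+1 case can be compared with one
    another. *)
Definition wronskian (F : nzRingType) (m n : nat) (f : 'I_n -> {poly F}) :
    'M[{poly F}]_(m, n) :=
  \matrix_(i, j) iter i (@euler F) (f j).

Lemma coef_iter_euler (F : comNzRingType) (i d : nat) (p : {poly F}) :
  (iter i (@euler F) p)`_d = d%:R ^+ i * p`_d.
Proof.
elim: i => [|i IHi]; first by rewrite mul1r.
rewrite iterS /euler coefXM coef_deriv; case: d IHi => [|d] IHi.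
  by rewrite exprS !mul0r.
by rewrite /= IHi -[LHS]mulr_natl exprS mulrA.
Qed.

Lemma size_iter_euler (F : comNzRingType) (i : nat) (p : {poly F}) :
  (size (iter i (@euler F) p) <= size p)%N.
Proof.
apply/leq_sizeP => d led.
by rewrite coef_iter_euler nth_default // mulr0.
Qed.

(** By the Leibniz rule, each application of [euler] costs at most one factor [u]. *)
Lemma dvdp_iter_euler (F : fieldType) (i n : nat) (u : {poly F}) :
  (i <= n)%N -> u ^+ (n - i) %| iter i (@euler F) (u ^+ n).
Proof.
elim: i => [|i IHi] lein; first by rewrite subn0 dvdpp.
rewrite iterS; have /dvdpP[q ->] := IHi (ltnW lein).
have -> : (n - i = (n - i.+1).+1)%N by lia.
rewrite /euler derivM deriv_exp /= dvdp_mull // dvdp_add //.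
  by rewrite dvdp_mull // dvdp_exp2l.
by rewrite -mulrnAl mulrA dvdp_mull.
Qed.

Lemma coefM_top (F : nzRingType) (p q : {poly F}) (s d : nat) :
  (size p <= s.+1)%N -> (size q <= d.+1)%N -> (p * q)`_(s + d) = p`_s * q`_d.
Proof.
move=> szp szq; have sP : (s < (s + d).+1)%N by lia.
rewrite coefM (bigD1 (Ordinal sP)) //= addKn big1 ?addr0 // => i /eqP nis.
have [lti|lei|/esym ei] := ltngtP s i; last by case: nis; apply: val_inj.
  by rewrite [p`__]nth_default ?mul0r // (leq_trans szp).
by rewrite [q`__]nth_default ?mulr0 // (leq_trans szq) //; lia.
Qed.

(* A vanishing determinant gives an operator L = sum_i v_i (x d/dx)^i, of order
   less than m, killing every f_j.  The top coefficient of L g is J(deg g) times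
   that of g, where J is the indicial polynomial of L at infinity.  As J has fewer
   than m roots, some nontrivial combination g of the f_j has no monomial whose
   degree is a root of J. *)
Lemma det_wronskian_neq0 (F : numFieldType) (m : nat) (f : 'I_m -> {poly F}) :
  independent F _ f -> \det (wronskian F m m f) != 0.
Proof.
move=> indf; apply/det0P => -[v v_neq0 vW].
pose s := (\max_i size (v 0%R i)).-1.
have [i0 vi0] : exists i, v 0 i != 0 by apply/rV0Pn.
have szv i : (size (v 0%R i) <= s.+1)%N.
  by apply: leq_trans (leqSpred _); apply: leq_bigmax.
pose J := \poly_(i < m) (if insub i is Some j then (v 0 j)`_s else 0).
have JE (i : 'I_m) : J`_i = (v 0 i)`_s.
  by rewrite coef_poly ltn_ord valK.
have J_neq0 : J != 0.
  have [|j ej] := @bigop.eq_bigmax _ (fun i => size (v 0 i)).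
    by apply/card_gt0P; exists i0.
  have szj : size (v 0 j) = s.+1.
    rewrite /s ej prednK // -ej (leq_trans _ (leq_bigmax i0)) //.
    by rewrite lt0n size_poly_eq0.
  apply/eqP => J0; have /eqP := JE j; rewrite J0 coef0 eq_sym.
  have -> : s = (size (v 0 j)).-1 by rewrite szj.
  by rewrite -lead_coefE lead_coef_eq0 -size_poly_eq0 szj.
pose B := (\max_i size (f i))%N.
pose E := [seq d <- iota 0 B | root J d%:R].
(* In characteristic zero distinct degrees are distinct roots of [J], which has size at most m. *)
have szE : (size E < m)%N.
  apply: (@leq_trans (size J)); last exact: size_poly.
  rewrite -(size_map (fun d : nat => d%:R : F)); apply: max_poly_roots => //.
    by apply/allP => x /mapP[d]; rewrite mem_filter => /andP[rd _] ->.
  rewrite map_inj_uniq ?filter_uniq ?iota_uniq //.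
  by move=> a b /eqP; rewrite eqr_nat => /eqP.
pose M := \matrix_(i < m, j < size E) (f i)`_(nth 0%N E j).
have : kermx M != 0.
  rewrite kermx_eq0 /row_free; apply/eqP => rM.
  by have := rank_leq_col M; rewrite rM leqNgt szE.
case/rowV0Pn => c /sub_kermxP cM c_neq0.
pose g := \sum_i c 0 i *: f i.
have g_neq0 : g != 0.
  apply: contraNneq c_neq0 => /indf c0; apply/eqP/rowP => i.
  by rewrite c0 mxE.
pose d := (size g).-1.
have szg : size g = d.+1 by rewrite prednK // lt0n size_poly_eq0.
have Lg : \sum_i v 0 i * iter i (@euler F) g = 0.
  have linE i : iter i (@euler F) g = \sum_j c 0 j *: iter i (@euler F) (f j).
    apply/polyP => e; rewrite coef_iter_euler !coef_sum mulr_sumr.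
    by apply: eq_bigr => j _; rewrite !coefZ coef_iter_euler mulrCA.
  under eq_bigr do rewrite linE mulr_sumr.
  rewrite exchange_big big1 // => j _.
  under eq_bigr do rewrite -scalerAr.
  rewrite -scaler_sumr; have /rowP/(_ j) := vW; rewrite !mxE.
  by under eq_bigr do rewrite mxE; move=> ->; rewrite scaler0.
have rd : root J d%:R.
  have /(congr1 (fun p : {poly F} => p`_(s + d))) := Lg.
  rewrite coef0 coef_sum.
  under eq_bigr => i _.
    rewrite coefM_top ?szv //; last by rewrite -szg size_iter_euler.
    rewrite coef_iter_euler mulrA -JE.
    over.
  rewrite -mulr_suml => /eqP; rewrite mulf_eq0 orbC.
  have -> /= : (g`_d == 0) = false.
    by apply/negbTE; rewrite /d -lead_coefE lead_coef_eq0.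
  by rewrite /root (@horner_coef_wide _ m) // size_poly.
have dE : d \in E.
  rewrite mem_filter rd mem_iota /= add0n.
  rewrite -szg; apply: leq_trans (size_sum _ _ _) _.
  apply/bigmax_leqP => i _; apply: leq_trans (size_scale_leq _ _) _.
  exact: leq_bigmax.
have : g`_d = 0.
  have kP : (index d E < size E)%N by rewrite index_mem.
  have /rowP/(_ (Ordinal kP)) := cM; rewrite !mxE => cM0.
  rewrite coef_sum -[RHS]cM0.
  by apply: eq_bigr => i _; rewrite coefZ mxE nth_index.
by apply/eqP; rewrite /d -lead_coefE lead_coef_eq0.
Qed.

(** * Root multiplicities and determinants of polynomial matrices *)

Lemma mup_exp (F : fieldType) (x : F) (p : {poly F}) (n : nat) :
  p != 0 -> mup x (p ^+ n) = (n * mup x p)%N.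
Proof.
move=> p0; elim: n => [|n IHn]; first by rewrite mupNroot // root1.
by rewrite exprS mupM ?expf_neq0 // IHn mulSn.
Qed.

Lemma mup_prod (F : fieldType) (x : F) (I : Type) (r : seq I)
    (f : I -> {poly F}) :
  (forall i, f i != 0) ->
  mup x (\prod_(i <- r) f i) = (\sum_(i <- r) mup x (f i))%N.
Proof.
move=> f0; elim: r => [|i r IHr]; first by rewrite !big_nil mupNroot // root1.
rewrite !big_cons mupM ?IHr //.
by elim/big_ind: _ => // [|p q]; [apply: oner_neq0 | apply: mulf_neq0].
Qed.

(** Over a closed field a nonconstant [p] has a root, which [q] shares; cancel this linear factor
    and induct on the size of [p]. *)
Lemma dvdp_mup (F : closedFieldType) (p q : {poly F}) :
  p != 0 -> q != 0 -> (forall x, mup x p <= mup x q)%N -> p %| q.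
Proof.
have [n] := ubnP (size p); elim: n p q => // n IHn p q ltn p0 q0 lepq.
have [sz1|/closed_rootP[x rx]] := eqVneq (size p) 1%N.
  by move/eqP: sz1; rewrite size_poly_eq1 => /eqp_dvdl ->; rewrite dvd1p.
have rq : 'X - x%:P %| q.
  by rewrite XsubC_dvd // (leq_trans _ (lepq x)) // -XsubC_dvd // dvdp_XsubCl.
move: rx; rewrite -dvdp_XsubCl => /dvdpP[p1 ep]; case/dvdpP: rq => q1 eq.
have X0 : 'X - x%:P != 0 by rewrite polyXsubC_eq0.
have p10 : p1 != 0 by apply: contraNneq p0 => p10; rewrite ep p10 mul0r.
have q10 : q1 != 0 by apply: contraNneq q0 => q10; rewrite eq q10 mul0r.
rewrite ep eq dvdp_mul2r //; apply: IHn => // [|y].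
  by move: ltn; rewrite ep size_Mmonic ?monicXsubC // size_XsubC addn2.
by have := lepq y; rewrite ep eq !mupM // leq_add2r.
Qed.

(** The factor [v j] comes out of column j: [A] is the matrix of quotients times a diagonal
    matrix. *)
Lemma dvdp_det (F : fieldType) (m : nat) (A : 'M[{poly F}]_m)
    (v : 'I_m -> {poly F}) :
  (forall i j, v j %| A i j) -> \prod_j v j %| \det A.
Proof.
move=> vA.
have -> : A = (\matrix_(i, j) (A i j %/ v j)) *m diag_mx (\row_j v j).
  by rewrite mul_mx_diag; apply/matrixP => i j; rewrite !mxE divpK.
rewrite det_mulmx det_diag dvdp_mull //.
by under [X in _ %| X]eq_bigr do rewrite mxE.
Qed.

(** Each term of the Leibniz expansion takes one entry from every column, so the column degree
    bounds add up. *)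
Lemma size_det_leq (F : idomainType) (m : nat) (A : 'M[{poly F}]_m)
    (d : 'I_m -> nat) :
  (forall i j, size (A i j) <= (d j).+1)%N -> (size (\det A) <= (\sum_j d j).+1)%N.
Proof.
move=> szA; apply: leq_trans (size_sum _ _ _) _; apply/bigmax_leqP => s _.
rewrite size_Msign; apply: leq_trans (size_poly_prod_leq _ _) _.
rewrite cardT size_enum_ord leq_subLR addnS ltnS.
rewrite [X in (_ <= _ + X)%N](reindex_inj (@perm_inj _ s)) /=.
have -> : (m + \sum_j d (s j) = \sum_j (1 + d (s j)))%N.
  by rewrite big_split sum1_card card_ord.
by rewrite leq_sum // => i _; rewrite add1n szA.
Qed.

(* Bordering A by a row orthogonal to a, supported on the columns i and j, gives
   a singular matrix. *)
Lemma proportional_minors (F : fieldType) (m : nat)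
    (A : 'M[{poly F}]_(m, m.+1)) (a : 'I_m.+1 -> F) :
  (forall j, a j != 0) -> (forall i, \sum_j a j *: A i j = 0) ->
  forall i j, exists2 c, c != 0 & \det (col' i A) = c *: \det (col' j A).
Proof.
move=> a0 aA i j; have [->|neq_ij] := eqVneq i j.
  by exists 1; rewrite ?oner_eq0 ?scale1r.
pose y k : {poly F} := if k == i then (a j)%:P else if k == j then - (a i)%:P else 0.
pose B := \matrix_(r < m.+1, k < m.+1) if unlift ord0 r is Some r' then A r' k else y k.
have sumy (g : 'I_m.+1 -> {poly F}) :
    \sum_k y k * g k = (a j)%:P * g i - (a i)%:P * g j.
  rewrite (bigD1 i) //= (bigD1 j) 1?eq_sym //= big1 ?addr0; last first.
    by move=> k /andP[ki kj]; rewrite /y (negbTE ki) (negbTE kj) mul0r.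
  by rewrite /y eqxx eq_sym (negbTE neq_ij) eqxx mulNr.
have detB0 : \det B = 0.
  apply/eqP; rewrite -det_tr; apply/det0P; exists (\row_k (a k)%:P).
    by apply/rV0Pn; exists i; rewrite mxE polyC_eq0.
  apply/rowP => r; rewrite !mxE.
  under eq_bigr do rewrite !mxE.
  case: unliftP => [r' _|_]; last first.
    under eq_bigr do rewrite mulrC.
    by rewrite sumy -!polyCM mulrC subrr.
  by under eq_bigr do rewrite mul_polyC; rewrite aA.
have minorB k : row' ord0 (col' k B) = col' k A.
  by apply/matrixP => r c; rewrite !mxE liftK.
(* Expansion along the bordering row has only two terms: up to sign, [a j] times the minor omitting
   [i] equals [a i] times the minor omitting [j]. *)
have : \sum_k y k * cofactor B ord0 k = 0.
  rewrite -[RHS]detB0 (expand_det_row _ ord0); apply: eq_bigr => k _.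
  by rewrite [X in _ = X * _]mxE unlift_none.
rewrite sumy /cofactor !minorB !add0n => /eqP; rewrite subr_eq0 => /eqP E.
exists ((-1) ^+ (i + j) * (a i / a j)).
  by rewrite !mulf_neq0 ?signr_eq0 ?invr_eq0.
apply: (scalerI (a0 j)); rewrite scalerA mulrCA [a j * _]mulrC divfK //.
apply: (can_inj (@signrMK {poly F} i)).
rewrite -!mul_polyC mulrCA E polyCM exprD polyCM.
have sgnC k : ((-1) ^+ k)%:P = (-1) ^+ k :> {poly F} by rewrite rmorphXn rmorphN1.
by rewrite !sgnC -!mulrA signrMK mulrCA.
Qed.

(** * Linear relations between N-th powers *)

Lemma deg_prod (F : idomainType) (I : finType) (p : I -> {poly F}) :
  (forall i, p i != 0) -> size (\prod_i p i) = (\sum_i (size (p i)).-1).+1.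
Proof.
move=> p0; rewrite size_prod // -sum1_card subSn ?leq_sum //; last first.
  by move=> i _; rewrite lt0n size_poly_eq0.
by rewrite -sumnB => [|i _]; rewrite ?lt0n ?size_poly_eq0 //; under eq_bigr do rewrite subn1.
Qed.

(* All maximal minors of the Wronskian of the u_i^N are proportional.  At x, the
   minor omitting some u_j with u_j(x) <> 0 vanishes to order at least
   sum_i (N - m + 1) mup x u_i, hence so do all of them; the minor omitting a u_j
   of maximal degree is then of too small degree. *)
Lemma coprime_power_relation (F : numClosedFieldType) (m N : nat)
    (u : 'I_m.+1 -> {poly F}) (a : 'I_m.+1 -> F) :
  (0 < m)%N -> (m ^ 2 <= N)%N -> (forall i, u i != 0) -> (forall i, a i != 0) ->
  (forall j : 'I_m.+1, independent F 'I_m (fun k => u (lift j k) ^+ N)) ->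
  \sum_i a i *: u i ^+ N = 0 ->
  (forall x, exists j, ~~ root (u j) x) ->
  forall i, size (u i) = 1%N.
Proof.
move=> m_gt0 leN u0 a0 indu au0 cop.
pose A := wronskian F m m.+1 (fun i => u i ^+ N).
have AE (j : 'I_m.+1) : col' j A = wronskian F m m (fun k => u (lift j k) ^+ N).
  by apply/matrixP => r k; rewrite !mxE.
have W0 j : \det (col' j A) != 0 by rewrite AE det_wronskian_neq0 //; apply: indu.
have relA r : \sum_j a j *: A r j = 0.
  apply/polyP => e.
  have /(congr1 (fun p : {poly F} => e%:R ^+ r * p`_e)) := au0.
  rewrite !coef_sum coef0 mulr0 mulr_sumr => au0e; rewrite -[RHS]au0e.
  by apply: eq_bigr => j _; rewrite !mxE !coefZ coef_iter_euler mulrCA.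
have leqm : (m <= N)%N by apply: leq_trans leN; rewrite expnS leq_pmulr ?expn1.
(* The last row of the Wronskian has order m-1, so every entry of a column keeps at least this power
   of its [u]. *)
pose q := (N - m.-1)%N.
have dvdW (j : 'I_m.+1) : \prod_k u (lift j k) ^+ q %| \det (col' j A).
  rewrite AE; apply: dvdp_det => r k; rewrite mxE.
  apply: dvdp_trans (dvdp_iter_euler F r N _ _); last first.
    by apply: leq_trans leqm; rewrite ltnW.
  by rewrite dvdp_exp2l // leq_sub2l // -ltnS prednK.
have uq0 i : u i ^+ q != 0 by rewrite expf_neq0.
have dvdall j : \prod_i u i ^+ q %| \det (col' j A).
  apply: dvdp_mup => // [|x]; first by apply/prodf_neq0.
  have [j0 nr] := cop x.
  have [c c0 ->] := proportional_minors F m A a a0 relA j j0.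
  rewrite -mul_polyC mupMr; last by rewrite rootC.
  rewrite mup_geq //; apply: dvdp_trans (dvdW j0).
  rewrite -mup_geq; last by apply/prodf_neq0.
  rewrite (bigD1_ord j0) //= mupMr //.
  by apply: contraNN nr; rewrite /root horner_exp expf_eq0 => /andP[].
pose d i := (size (u i)).-1.
have szu i : size (u i) = (d i).+1 by rewrite prednK // lt0n size_poly_eq0.
have ineq (j : 'I_m.+1) : (q * \sum_i d i <= N * \sum_k d (lift j k))%N.
  have := dvdp_leq (W0 j) (dvdall j); rewrite deg_prod //.
  have szW : (size (\det (col' j A)) <= (\sum_k d (lift j k) * N).+1)%N.
    apply: size_det_leq => r k; rewrite !mxE; apply: leq_trans (size_iter_euler _ _ _) _.
    by rewrite -size_exp leqSpred.
  move=> /leq_trans/(_ szW); rewrite ltnS -big_distrl /= [(N * _)%N]mulnC.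
  by under eq_bigr do rewrite size_exp; rewrite -big_distrl /= mulnC.
pose j := [arg max_(j > ord0) d j].
have dj i : (d i <= d j)%N by rewrite /j; case: arg_maxnP => // k _; apply.
have lesum : (\sum_k d (lift j k) <= m * d j)%N.
  by rewrite -[X in (X * _)%N]card_ord -sum_nat_const leq_sum.
move: (ineq j); rewrite (bigD1_ord j) //= => ineqj i.
suff dj0 : d j = 0%N by rewrite szu; have := dj i; rewrite dj0 leqn0 => /eqP ->.
apply/eqP; rewrite -leqn0 leqNgt; apply/negP => dj_gt0.
(* With D = [d j] > 0 and s <= m D, the inequality (N-m+1)(D+s) <= N s gives (N-m+1) D <= (m-1) s <=
   (m-1) m D, hence N < m^2, a contradiction. *)
move: lesum ineqj; rewrite /q; move: (\sum_(_ < _) _)%N => s; nia.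
Qed.

(** Common linear factors are divided out one at a time, which preserves all hypotheses. Once no
    common root is left, all [u i] are constants. *)
Lemma power_relation (F : numClosedFieldType) (m N : nat)
    (u : 'I_m.+1 -> {poly F}) (a : 'I_m.+1 -> F) :
  (0 < m)%N -> (m ^ 2 <= N)%N -> (forall i, u i != 0) -> (forall i, a i != 0) ->
  (forall j : 'I_m.+1, independent F 'I_m (fun k => u (lift j k) ^+ N)) ->
  \sum_i a i *: u i ^+ N = 0 ->
  exists d c, forall i, u i = c i *: d.
Proof.
move=> m_gt0 leN; have [n] := ubnP (size (u ord0)).
elim: n u => // n IHn u ltn u0 a0 indu au0.
have [[x rx]|nr] := EM (exists x, forall j, root (u j) x); last first.
  exists 1, (fun i => (u i)`_0) => i.
  rewrite alg_polyC -size1_polyC //.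
  rewrite (@coprime_power_relation F m N u a) // => x.
  apply: contrapT => /forallNP nrx; apply: nr; exists x => j.
  by apply: contrapT => /negP; apply: nrx.
have X0 : 'X - x%:P != 0 by rewrite polyXsubC_eq0.
have XN0 : ('X - x%:P) ^+ N != 0 by rewrite expf_neq0.
pose v i := u i %/ ('X - x%:P).
have uE i : u i = v i * ('X - x%:P) by rewrite divpK // dvdp_XsubCl.
have v0 i : v i != 0 by apply: contraNneq (u0 i) => vi0; rewrite uE vi0 mul0r.
have relv (I : finType) (g : I -> 'I_m.+1) (c : I -> F) :
    \sum_i c i *: u (g i) ^+ N = (\sum_i c i *: v (g i) ^+ N) * ('X - x%:P) ^+ N.
  by rewrite mulr_suml; apply: eq_bigr => i _; rewrite uE exprMn scalerAl.
have [|||j c cv0|| d [c vE]] := IHn v.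
- by move: ltn; rewrite uE size_Mmonic ?monicXsubC // size_XsubC addn2.
- exact: v0.
- exact: a0.
- by apply: (indu j); rewrite relv cv0 mul0r.
- by apply/eqP; rewrite -(inj_eq (mulIf XN0)) mul0r -(relv _ id) au0.
by exists (d * ('X - x%:P)), c => i; rewrite uE vE scalerAl.
Qed.

(** Induction on n: all proper subfamilies are independent, so a nontrivial relation has no zero
    coefficient. Then all [u i] are multiples of one polynomial, against nonproportionality. *)
Lemma independent_powers (F : numClosedFieldType) (n N : nat)
    (u : 'I_n -> {poly F}) :
  (n ^ 2 <= N)%N -> (forall i, u i != 0) ->
  (forall i j b, i != j -> u i ^+ N <> b *: u j ^+ N) ->
  independent F 'I_n (fun i => u i ^+ N).
Proof.
elim: n u => [|m IHm] u leN u0 npu c cu0; first by case.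
have leN' : (m ^ 2 <= N)%N by apply: leq_trans leN; rewrite leq_exp2r.
have indl (j : 'I_m.+1) : independent F 'I_m (fun k => u (lift j k) ^+ N).
  apply: IHm => // i k b neq; apply: npu.
  by rewrite (inj_eq (@lift_inj _ _)).
have [[j cj0] i|/forallNP c0] := EM (exists j, c j = 0).
  move: cu0; rewrite (bigD1_ord j) //= cj0 scale0r add0r => /indl cl0.
  by case: (unliftP j i) => [k|] ->.
have {}c0 j : c j != 0 by apply/eqP.
have [m0|m_gt0] := posnP m.
  move: cu0; rewrite big_ord_recl big1 ?addr0 => [/eqP|]; last first.
    by case=> i lti; have: (i < 0)%N by rewrite -m0.
  by rewrite scaler_eq0 (negbTE (c0 _)) expf_eq0 (negbTE (u0 _)) andbF.
have [d [e uE]] := power_relation F m N u c m_gt0 leN' u0 c0 indl cu0.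
have e0 i : e i != 0.
  by apply: contraNneq (u0 i) => ei0; rewrite uE ei0 scale0r.
have neq : ord0 != lift ord0 (Ordinal m_gt0) by rewrite neq_lift.
case: (npu _ _ (e ord0 ^+ N / e (lift ord0 (Ordinal m_gt0)) ^+ N) neq).
by rewrite ![u _]uE !exprZn scalerA divfK // expf_neq0.
Qed.

(** * Equal sums of congruent polynomials *)

Local Open Scope fset_scope.

(** Split off the N-th power of one linear factor at a time; the remaining constant has an N-th root
    in [F]. *)
Lemma exact_power (F : numClosedFieldType) (N : nat) (p : {poly F}) :
  (0 < N)%N -> p != 0 -> (forall x, N %| mup x p)%N -> exists u, p = u ^+ N.
Proof.
move=> N_gt0; have [n] := ubnP (size p); elim: n p => // n IHn p ltn p0 Np.
have [/eqP/size_poly1P[c c0 ->]|/closed_rootP[x rx]] := eqVneq (size p) 1%N.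
  by exists (N.-root c)%:P; rewrite -polyC_exp rootCK.
have Nlex : (N <= mup x p)%N.
  by rewrite dvdn_leq // -XsubC_dvd // dvdp_XsubCl.
move: Nlex; rewrite mup_geq // => /dvdpP[p1 ep].
have XN0 : ('X - x%:P) ^+ N != 0 by rewrite expf_neq0 // polyXsubC_eq0.
have p10 : p1 != 0 by apply: contraNneq p0 => p10; rewrite ep p10 mul0r.
have [||y|u eu] := IHn p1; last by exists (u * ('X - x%:P)); rewrite ep eu exprMn.
- move: ltn; rewrite ep size_Mmonic ?monic_exp ?monicXsubC //.
  by rewrite size_exp_XsubC addnS /=; lia.
- exact: p10.
have := Np y; rewrite ep mupM // mup_XsubCX dvdn_addl //.
by case: eqP.
Qed.

Lemma independent_powers_in (F : numClosedFieldType) (I : finType)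
    (B : {set I}) (N : nat) (u : I -> {poly F}) (c : I -> F) :
  (#|B| ^ 2 <= N)%N -> (forall i, i \in B -> u i != 0) ->
  (forall i j b, i \in B -> j \in B -> i != j -> u i ^+ N <> b *: u j ^+ N) ->
  \sum_(i in B) c i *: u i ^+ N = 0 -> forall i, i \in B -> c i = 0.
Proof.
move=> leN u0 npu cu0 i iB; rewrite big_enum_val in cu0.
have := @independent_powers F #|B| N (u \o enum_val) leN _ _ _ cu0 (enum_rank_in iB i).
rewrite /= enum_rankK_in //; apply => [j|j k b njk].
  by apply: u0; apply: enum_valP.
by apply: npu; rewrite ?enum_valP // (inj_eq enum_val_inj).
Qed.

(** Double counting. Used with [M] = 1 for products, and with [M] = k^k for sums, which fix their
    summands only up to arrangement. *)
Lemma card_le_fibers (X : finType) (A : {pred X}) (Y : choiceType)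
    (f : X -> Y) (Z : {fset Y}) (M : nat) :
  (forall x, x \in A -> f x \in Z) ->
  (forall y, (#|[pred x in A | f x == y]| <= M)%N) -> (#|A| <= M * #|` Z|)%N.
Proof.
move=> AZ fib; rewrite -sum1_card.
have -> : (\sum_(x in A) 1 = \sum_(x in A) \sum_(y <- Z) (f x == y))%N.
  apply: eq_bigr => x /AZ fxZ.
  by rewrite (bigD1_seq (f x)) ?fset_uniq //= eqxx big1 // => y /negbTE; rewrite eq_sym => ->.
have -> : (M * #|` Z| = \sum_(y <- Z) M)%N.
  by rewrite big_const_seq count_predT iter_addn addn0.
rewrite exchange_big leq_sum //= => y _; apply: leq_trans (fib y).
by rewrite -sum1_card [leqRHS]big_mkcondr /=; apply: eq_leq; apply: eq_bigr => x _; case: eqP.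
Qed.

(* For nonzero p and q over an algebraically closed field, this says that p / q is
   an N-th power of a rational function. *)
Definition mup_congr (F : fieldType) (N : nat) (p q : {poly F}) : Prop :=
  forall x, mup x p = mup x q %[mod N].

(* Multiplication by g = (s' j)^(N-1) turns every summand into an N-th power. *)
Lemma sum_inj_mup_congr (F : numClosedFieldType) (k N : nat)
    (S : {fset {poly F}}) (s s' : 'I_k -> S) :
  ((2 * k) ^ 2 <= N)%N -> (0 < k)%N ->
  (forall p, p \in S -> p != 0) ->
  (forall p q : {poly F}, p \in S -> q \in S -> p != q -> forall a, p <> a *: q) ->
  (forall i j, mup_congr F N (val (s i)) (val (s' j))) ->
  (forall i j, mup_congr F N (val (s' i)) (val (s' j))) ->
  \sum_i val (s i) = \sum_i val (s' i) ->
  forall j, exists i, s' j = s i.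
Proof.
move=> leN k_gt0 S0 npS css' cs's' eqs j.
have N_gt0 : (0 < N)%N by apply: leq_trans leN; rewrite expn_gt0; lia.
pose B := s @: predT :|: s' @: predT.
have B0 (t : S) : val t != 0 by apply: S0; apply: valP.
pose g := val (s' j) ^+ N.-1.
have g0 : g != 0 by rewrite expf_neq0.
have [u uE] : exists u : S -> {poly F}, forall t, t \in B -> val t * g = u t ^+ N.
  suff /choice[u uE] : forall t, exists v, t \in B -> val t * g = v ^+ N by exists u.
  move=> t; have [tB|] := boolP (t \in B); last by exists 0.
  have [||v ->] := @exact_power F N (val t * g) N_gt0; last by exists v.
    by rewrite mulf_neq0.
  (* The multiplicity of [val t * g] at [x] is congruent to N times that of [s' j], hence to 0. *)
  move=> x; rewrite mupM // mup_exp // /dvdn.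
  have /(_ x) ct : mup_congr F N (val t) (val (s' j)).
    by case/setUP: tB => /imsetP[i _ ->].
  by rewrite -modnDml ct modnDml -mulSn prednK // modnMr.
have multiplicity (r : 'I_k -> S) : {subset r @: predT <= B} ->
    \sum_i val (r i) = \sum_(t in B) #|[pred i | r i == t]|%:R *: val t.
  move=> rB; rewrite (partition_big r (fun t => t \in B)) /= => [|i _]; last first.
    by apply: rB; apply: imset_f.
  apply: eq_bigr => t _; rewrite scaler_nat -sumr_const.
  by apply: eq_big => // i /eqP ->.
(* The multiplicity of [t] in [s] minus that in [s']. Independence makes it vanish on [B], so [s' j]
   occurs in [s] as often as in [s']. *)
pose c t : F := #|[pred i | s i == t]|%:R - #|[pred i | s' i == t]|%:R.
have cB : \sum_(t in B) c t *: u t ^+ N = 0.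
  transitivity ((\sum_(t in B) c t *: val t) * g).
    by rewrite mulr_suml; apply: eq_bigr => t /uE <-; rewrite scalerAl.
  under eq_bigr do rewrite scalerBl.
  rewrite sumrB -!multiplicity ?eqs ?subrr ?mul0r // => t tr; rewrite inE tr //.
  by rewrite orbT.
have szB : (#|B| ^ 2 <= N)%N.
  apply: leq_trans leN; rewrite leq_exp2r // mul2n -addnn.
  apply: leq_trans (leq_card_setU _ _) _.
  by rewrite leq_add // (leq_trans (leq_imset_card _ _)) // -[leqRHS]card_ord max_card.
have u0 t : t \in B -> u t != 0.
  move=> tB; apply/eqP => ut0; have /eqP := uE t tB.
  by rewrite ut0 expr0n eqn0Ngt N_gt0 mulf_eq0 (negbTE (B0 t)) (negbTE g0).
have npu t t' b : t \in B -> t' \in B -> t != t' -> u t ^+ N <> b *: u t' ^+ N.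
  move=> tB t'B neq; rewrite -!uE // scalerAl => /(mulIf g0).
  by apply: npS; rewrite ?(valP t) ?(valP t').
have s'jB : s' j \in B by rewrite inE (imset_f s') ?orbT.
have /eqP := independent_powers_in F _ B N u c szB u0 npu cB _ s'jB.
rewrite subr_eq0 eqr_nat => /eqP eqcard.
have : (0 < #|[pred i | s i == s' j]|)%N.
  by rewrite eqcard; apply/card_gt0P; exists j; rewrite inE.
by case/card_gt0P => i; rewrite inE => /eqP; exists i.
Qed.

(** * Lower bound for the product set *)

(** The values of [e] may exceed N, so they are not digits. Their residues still identify the first
    entry, whose whole contribution is cancelled before dividing by N. *)
Lemma base_digits_inj (I A : Type) (N : nat) (e : I -> A -> nat) (t : nat)
    (s s' : 'I_t -> I) :
  (0 < N)%N ->
  (forall i j, (forall x, e (s i) x = e (s' j) x %[mod N]) -> s i = s' j) ->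
  (forall x, \sum_(i < t) N ^ i * e (s i) x = \sum_(i < t) N ^ i * e (s' i) x)%N ->
  s =1 s'.
Proof.
move=> N_gt0; elim: t s s' => [|t IHt] s s' inje sums; first by case.
have expand (r : 'I_t.+1 -> I) x : (\sum_(i < t.+1) N ^ i * e (r i) x =
    (\sum_(i < t) N ^ i * e (r (lift ord0 i)) x) * N + e (r ord0) x)%N.
  rewrite big_ord_recl expn0 mul1n addnC big_distrl; congr (_ + _)%N.
  by apply: eq_bigr => i _; rewrite lift0 expnS -mulnA mulnC.
have s0 : s ord0 = s' ord0.
  apply: inje => x; have := congr1 (modn^~ N) (sums x).
  by rewrite !expand !modnMDl.
move=> i; case: (unliftP ord0 i) => [j|] -> //.
apply: (IHt (s \o lift ord0) (s' \o lift ord0)) => [*|x]; first exact: inje.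
have := sums x; rewrite !expand s0 => /addIn/eqP.
by rewrite eqn_pmul2r // => /eqP.
Qed.

Lemma prodset_mul (T : comPzSemiRingType) (a b : nat) (S : {fset T}) (p q : T) :
  p \in prodset a S -> q \in prodset b S -> p * q \in prodset (a + b) S.
Proof.
move=> /prodsetP[s sS ->] /prodsetP[r rS ->]; apply/prodsetP.
exists (fun i => match fintype.split i with inl i => s i | inr i => r i end).
  by move=> i; case: fintype.split.
rewrite big_split_ord; congr (_ * _); apply: eq_bigr => i _.
  by rewrite (unsplitK (inl i)).
by rewrite (unsplitK (inr i)).
Qed.

Lemma prodset_exp (T : comPzSemiRingType) (a : nat) (S : {fset T}) (p : T) :
  p \in S -> p ^+ a \in prodset a S.
Proof.
by move=> pS; apply/prodsetP; exists (fun=> p); rewrite // prodr_const card_ord.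
Qed.

Lemma prodset_prod (T : comPzSemiRingType) (t : nat) (a : 'I_t -> nat)
    (S : {fset T}) (p : 'I_t -> T) :
  (forall i, p i \in prodset (a i) S) -> \prod_i p i \in prodset (\sum_i a i) S.
Proof.
elim: t a p => [|t IHt] a p pS; last first.
  by rewrite !big_ord_recr prodset_mul // IHt.
by rewrite !big_ord0; apply/prodsetP; exists (fun=> 0) => [[]|]; rewrite ?big_ord0.
Qed.

Lemma card_prodset_ge (F : fieldType) (N t l : nat) (S : {fset {poly F}}) (Q : {set S}) :
  (0 < N)%N -> (\sum_(i < t) N ^ i <= l)%N -> S != fset0 ->
  (forall p, p \in S -> p != 0) ->
  (forall p q, p \in Q -> q \in Q -> mup_congr F N (val p) (val q) -> p = q) ->
  (#|Q| ^ t <= #|` prodset l S|)%N.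
Proof.
move=> N_gt0 lel /fset0Pn[p0 p0S] S0 Qinj.
have v0 (p : S) : val p != 0 by apply: S0; apply: valP.
(* The factor p0^b pads the product to exactly l factors. *)
pose b := (l - \sum_(i < t) N ^ i)%N.
pose f (s : {ffun 'I_t -> S}) := \prod_i val (s i) ^+ (N ^ i) * p0 ^+ b.
rewrite -[X in (_ ^ X <= _)%N]card_ord -(card_ffun_on _ (mem Q)) -[leqRHS]mul1n.
apply: (@card_le_fibers _ _ _ f) => [s _|y].
  rewrite -(subnKC lel) prodset_mul ?prodset_exp //.
  by apply: prodset_prod => i; apply: prodset_exp; apply: valP.
apply/card_le1_eqP => s s'; rewrite !inE => /andP[/ffun_onP sQ /eqP <-].
move=> /andP[/ffun_onP s'Q /eqP].
rewrite /f => /(mulIf (expf_neq0 _ (S0 _ p0S))) eqprod.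
have mupf (r : {ffun 'I_t -> S}) x :
    mup x (\prod_i val (r i) ^+ (N ^ i)) = (\sum_(i < t) N ^ i * mup x (val (r i)))%N.
  rewrite mup_prod => [|i]; last by rewrite expf_neq0.
  by apply: eq_bigr => i _; rewrite mup_exp.
apply/ffunP/(@base_digits_inj S F N (fun p x => mup x (val p)) t) => // [i j|x].
  by apply: Qinj; [apply: s'Q | apply: sQ].
by rewrite -!mupf eqprod.
Qed.

(** * A large congruence class and its sumset *)

(** Pigeonhole: [Q] holds one representative of each class and [T] is a largest class. *)
Lemma exists_large_class (F : fieldType) (N : nat) (S : {fset {poly F}}) :
  S != fset0 ->
  exists T Q : {set S}, [/\ (#|` S| <= #|Q| * #|T|)%N,
    forall p q, p \in T -> q \in T -> mup_congr F N (val p) (val q) &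
    forall p q, p \in Q -> q \in Q -> mup_congr F N (val p) (val q) -> p = q].
Proof.
move=> /fset0Pn[p0 p0S].
pose rel (p q : S) := `[< mup_congr F N (val p) (val q) >].
(* [pick] depends only on the extension of the predicate, so congruent elements get the same
   representative; by reflexivity the default [p] never arises. *)
pose rep (p : S) := odflt p [pick q | rel p q].
have repP p : mup_congr F N (val p) (val (rep p)).
  by rewrite /rep; case: pickP => [q /asboolP //|/(_ p)/asboolP np]; case: np.
have rep_eq p q : mup_congr F N (val p) (val q) -> rep p = rep q.
  move=> pq; rewrite /rep.
  have relE : rel p =1 rel q.
    by move=> r; apply: asbool_equiv_eq; split=> h x; rewrite -h pq.
  by rewrite (eq_pick relE); case: pickP => // /(_ q)/asboolP nq; case: nq.
pose Q := rep @: predT.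
pose fiber q := [set p : S | rep p == q]%SET.
pose q0 := [arg max_(q > [` p0S] in predT) #|fiber q|].
exists (fiber q0), Q; split.
- rewrite -sum_nat_const cardfE -[leqLHS]sum1_card.
  rewrite (partition_big rep (fun q => q \in Q)) /=;
    last by move=> p _; apply: imset_f.
  rewrite leq_sum // => q _.
  rewrite sum1_card /q0; case: arg_maxnP => // q1 _ /(_ q isT); apply: leq_trans.
  by apply: eq_leq; apply: eq_card => p; rewrite !inE.
- move=> p q; rewrite !inE => /eqP ep /eqP eq x; rewrite (repP p) ep -eq.
  by rewrite -(repP q).
move=> _ _ /imsetP[p _ ->] /imsetP[q _ ->] pq; apply: rep_eq => x.
by rewrite (repP p) pq -(repP q).
Qed.

(** Fix one tuple [s] with a given sum. Any other tuple from [T] with that sum is [s] composed with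
    a map from ['I_k] to itself, so there are at most k^k of them. *)
Lemma card_sumset_ge (F : numClosedFieldType) (k N : nat) (S : {fset {poly F}})
    (T : {set S}) :
  ((2 * k) ^ 2 <= N)%N -> (0 < k)%N ->
  (forall p, p \in S -> p != 0) ->
  (forall p q : {poly F}, p \in S -> q \in S -> p != q -> forall a, p <> a *: q) ->
  (forall p q, p \in T -> q \in T -> mup_congr F N (val p) (val q)) ->
  (#|T| ^ k <= k ^ k * #|` sumset k S|)%N.
Proof.
move=> leN k_gt0 S0 npS congrT.
rewrite -[X in (_ ^ X <= _)%N]card_ord -(card_ffun_on _ (mem T)).
apply: (@card_le_fibers _ _ _ (fun s : {ffun 'I_k -> S} => \sum_i val (s i))).
  by move=> s _; apply/sumsetP; exists (fun i => val (s i)) => // i; apply: valP.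
move=> y; set P := [pred _ in _ | _].
have [->//|/card_gt0P[s]] := posnP #|P|.
rewrite !inE => /andP[/ffun_onP sT /eqP sy].
pose h (r : {ffun 'I_k -> 'I_k}) := [ffun i => s (r i)].
have -> : (k ^ k = #|{ffun 'I_k -> 'I_k}|)%N by rewrite card_ffun card_ord.
apply: leq_trans (leq_imset_card h predT).
apply: subset_leq_card; apply/fintype.subsetP => s'; rewrite !inE => /andP[/ffun_onP s'T /eqP s'y].
have /choice[r rE] : forall j, exists i, s' j = s i.
  apply: (@sum_inj_mup_congr F k N S s s') => // [i j|i j|]; rewrite ?sy ?s'y //.
    by apply: congrT; [apply: sT | apply: s'T].
  by apply: congrT; apply: s'T.
apply/imsetP; exists (finfun r) => //.
by apply/ffunP => i; rewrite !ffunE rE.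
Qed.

(** * Exponents, limits and the conclusion *)

Local Open Scope classical_set_scope.

(** Taking base N+1 absorbs the geometric sum, so t = [trunc_log N.+1 l] leaves room for t+1 base-N
    digits among l factors. *)
Lemma sum_expn_leq (N t : nat) : (\sum_(i < t.+1) N ^ i <= N.+1 ^ t)%N.
Proof.
elim: t => [|t IHt]; first by rewrite big_ord_recl big_ord0.
rewrite big_ord_recr /= [leqRHS]expnS mulSn leq_add // expnS leq_mul //.
by case: t {IHt} => // t; rewrite leq_exp2r.
Qed.

(** Here m < n^(c/(t+1)) and k^k < n^(1/(t+1)), so n^k <= m^k k^k s < n^((kc+1)/(t+1)) s. The
    summand 1 in the exponent pays for k^k. *)
Lemma powR_sub_lt (R : realType) (n m tau s k t : nat) (c : R) :
  (0 < n)%N -> (0 < k)%N -> (n <= m * tau)%N ->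
  (m ^ t.+1)%:R < (n%:R : R) `^ c ->
  (tau ^ k <= k ^ k * s)%N -> ((k ^ k) ^ t.+1 < n)%N ->
  (n%:R : R) `^ (k%:R - (k%:R * c + 1) / t.+1%:R) < s%:R.
Proof.
move=> n_gt0 k_gt0 le_n_mtau lt_m le_tau lt_k.
have t0 : (t.+1%:R : R) != 0 by rewrite pnatr_eq0.
have x0 : 0 < n%:R :> R by rewrite ltr0n.
have root_lt (a : nat) (e : R) : (a ^ t.+1)%:R < n%:R `^ e -> a%:R < n%:R `^ (e / t.+1%:R).
  move=> /(@gt0_ltr_powR R t.+1%:R^-1 _); rewrite invr_gt0 ltr0n => /(_ isT).
  rewrite -powRrM natrX -powR_mulrn // -powRrM divff // powRr1 //.
  by apply; rewrite nnegrE ?powR_ge0 ?exprn_ge0.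
have m_lt := root_lt _ _ lt_m.
have k_lt : (k ^ k)%:R < (n%:R : R) `^ (1 / t.+1%:R).
  by apply: root_lt; rewrite powRr1 // ltr_nat.
have mk_le : (m ^ k)%:R <= (n%:R : R) `^ (k%:R * c / t.+1%:R).
  rewrite -mulrA mulrC powRrM powR_mulrn ?powR_ge0 // natrX lerXn2r ?nnegrE ?powR_ge0 //.
  exact: ltW.
have nk_le : (n ^ k <= m ^ k * (k ^ k * s))%N.
  by apply: leq_trans (leq_mul (leqnn _) le_tau); rewrite -expnMn leq_exp2r.
have s_gt0 : (0 < s)%N.
  rewrite lt0n; apply: contraTneq nk_le => ->.
  by rewrite !muln0 -ltnNge expn_gt0 n_gt0.
have m_gt0 : (0 < m)%N.
  by rewrite lt0n; apply: contraTneq le_n_mtau => ->; rewrite -ltnNge.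
rewrite powRB ?(gt_eqF x0) ?implybT // powR_mulrn // ltr_pdivrMr ?powR_gt0 //.
apply: (@le_lt_trans _ _ (m ^ k * (k ^ k * s))%:R).
  by rewrite -natrX ler_nat.
rewrite mulrDl powRD ?(gt_eqF x0) ?implybT // !natrM mulrA [ltRHS]mulrC.
rewrite ltr_pM2r ?ltr0n //.
apply: (@le_lt_trans _ _ (n%:R `^ (k%:R * c / t.+1%:R) * (k ^ k)%:R)).
  by rewrite ler_wpM2r.
by rewrite ltr_pM2l // powR_gt0.
Qed.

Lemma cvg_trunc_log (b : nat) : (1 < b)%N -> trunc_log b l @[l --> \oo] --> \oo.
Proof.
move=> b_gt1; apply/cvgnyPge => A; exists (b ^ A)%N => // l /= leAl.
exact: trunc_log_max.
Qed.

Theorem theorem3 (R : realType) :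
  exists f : R -> nat -> nat -> R,
    (forall (c : R) (k : nat), 1 <= c -> (1 <= k)%N ->
       f c k l @[l --> \oo] --> (0 : R)) /\
    (forall (c : R) (l k : nat), 1 <= c -> (1 <= l)%N -> (1 <= k)%N ->
       exists n0 : nat, forall n : nat, (n0 <= n)%N ->
         forall S : {fset {poly R[i]}},
           #|` S| = n ->
           (forall p q : {poly R[i]}, p \in S -> q \in S -> p != q ->
              forall a : R[i], p <> a *: q) ->
           (#|` prodset l S|)%:R < (n%:R : R) `^ c ->
           (n%:R : R) `^ (k%:R - f c k l) < (#|` sumset k S|)%:R).
Proof.
pose N k := ((2 * k) ^ 2)%N.
pose t k l := trunc_log (N k).+1 l.
have N_gt0 k : (0 < k)%N -> (0 < N k)%N by move=> k0; rewrite expn_gt0 muln_gt0 k0.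
exists (fun c k l => ((k%:R * c + 1) / (t k l).+1%:R)%R); split=> [c k _ k_gt0|c l k _ l_gt0 k_gt0].
  rewrite -[0](mulr0 (k%:R * c + 1)%R); apply: cvgM; first exact: cvg_cst.
  have cvgt := cvg_trunc_log (N k).+1 (N_gt0 _ k_gt0).
  exact: (cvg_comp (trunc_log (N k).+1) (@harmonic R) cvgt cvg_harmonic).
(* The power gives k^k < n^(1/(t+1)); the added 2 makes this strict and ensures n > 1. *)
exists ((k ^ k) ^ (t k l).+1 + 2)%N => n len S cardS npS ltP.
have n_gt1 : (1 < n)%N by apply: leq_trans len; rewrite leq_addl.
have S_neq0 : S != fset0 by rewrite -cardfs_gt0 cardS ltnW.
(* Zero is a scalar multiple of every polynomial, so a set containing it could have no second
   element. *)
have S0 p : p \in S -> p != 0.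
  move=> pS; apply: contraTneq n_gt1 => p0; rewrite -cardS -leqNgt.
  rewrite -(cardfs1 p) fsubset_leq_card //; apply/fsubsetP => q qS.
  rewrite inE; apply: contrapT => /negP; rewrite eq_sym => npq.
  by apply: (npS p q pS qS npq 0); rewrite scale0r.
have [T [Q [le_n congrT injQ]]] := @exists_large_class R[i] (N k) S S_neq0.
have le_l : (\sum_(i < (t k l).+1) N k ^ i <= l)%N.
  by apply: leq_trans (sum_expn_leq _ _) _; apply: trunc_logP; rewrite // ltnS N_gt0.
have leP := @card_prodset_ge R[i] (N k) _ l S Q (N_gt0 _ k_gt0) le_l S_neq0 S0 injQ.
apply: (@powR_sub_lt R n #|Q| #|T|) => //.
- exact: ltnW.
- by rewrite -cardS.
- by apply: le_lt_trans ltP; rewrite ler_nat.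
- exact: (@card_sumset_ge R[i] k (N k) S T).
by apply: leq_trans len; rewrite addn2.
Qed.
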